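(* Let $\Gamma^\vee$ be a join-closed move semigroup. Let $D=(l,u)$ be an open interval and assume that the move $\gamma|_D$ is the limit of a sequence $\{\gamma^i|_{D^i}\}_{i\in\mathbb{N}}$ of moves in $\Gamma^\vee$ with $\gamma^i\ne\gamma$ for every $i$, in the following sense: $\gamma^i\to\gamma$, and either $D^i=D$ for all $i$, or, more generally, $D^i=(l^i,u^i)$ with $l^i\to l$ and $u^i\to u$. Let $I=\gamma(D)$. Then: 1. If $\gamma$ is a translation, then $\mathrm{moves}_+\bigl((D\cup I)\times(D\cup I)\bigr)\subseteq\mathrm{join}(\lim(\Gamma^\vee))$. 2. If $\gamma$ is a reflection, then $\mathrm{moves}_-\bigl((D\times I)\cup(I\times D)\bigr)\subseteq\mathrm{join}(\lim(\Gamma^\vee))$ and $\mathrm{moves}_+\bigl((D\times D)\cup(I\times I)\bigr)\subseteq\mathrm{join}(\lim(\Gamma^\vee))$.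
   Context: For $t,r\in\mathbb{R}$ let $\tau_t(x)=x+t$ (translation) and $\rho_r(x)=r-x$ (reflection), as bijections of $\mathbb{R}$. A move $\gamma|_D$ is the restriction of a translation or reflection $\gamma$ to a set $D\subseteq\mathbb{R}$ that is an open interval or empty, viewed as a partial bijection $D\to\gamma(D)$. Moves with nonempty domain are equal iff both $\gamma$ and $D$ agree; all empty translations are identified to one object $\tau|_\emptyset$, all empty reflections to one object $\rho|_\emptyset\neq\tau|_\emptyset$. Composition: $\gamma_2|_{D_2}\circ\gamma_1|_{D_1}=(\gamma_2\circ\gamma_1)|_{D_1\cap\gamma_1^{-1}(D_2)}$; inverse: $(\gamma|_D)^{-1}=\gamma^{-1}|_{\gamma(D)}$. A move ensemble is a set of moves; a move semigroup is a move ensemble closed under composition and inverse. A move ensemble is join-closed if it satisfies (restrict): if $\gamma|_D$ is in it and $D'\subseteq D$ is an open interval or empty, then $\gamma|_{D'}$ is in it; and (continuation): if $\gamma|_I$ is in it for all $I$ in a family whose union $D$ is an interval, then $\gamma|_D$ is in it. $\mathrm{join}(\Omega)$ is the smallest join-closed ensemble containing $\Omega$. A sequence of unrestricted moves $\gamma^i$ converges to a translation $\tau_t$ (resp. reflection $\rho_r$), written $\gamma^i\to\gamma$, if all but finitely many $\gamma^i$ are translations $\tau_{t^i}$ with $t^i\to t$ (resp. reflections $\rho_{r^i}$ with $r^i\to r$). $\lim(\Omega)$ is the smallest move ensemble $\bar\Omega\supseteq\Omega$ such that for every open interval $D$: if $\gamma^i\to\gamma$ and $\gamma^i|_D\in\bar\Omega$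 for all $i$, then $\gamma|_D\in\bar\Omega$. For $O\subseteq\mathbb{R}^2$, $\mathrm{moves}_+(O)$ (resp. $\mathrm{moves}_-(O)$) is the set of translation (resp. reflection) moves $\gamma|_D$, $D$ an open interval or empty, with graph $\{(x,\gamma(x)):x\in D\}\subseteq O$. *)

(* Defs.v *)
From HB Require Import structures.
From mathcomp Require Import all_boot all_order all_algebra.
From mathcomp Require Import all_classical all_reals all_analysis.
From mathcomp Require Import ring.
Set Implicit Arguments.
Unset Strict Implicit.
Unset Printing Implicit Defensive.
Import Order.TTheory GRing.Theory Num.Theory numFieldNormedType.Exports.
Local Open Scope classical_set_scope.
Local Open Scope ring_scope.

Inductive umove (R : realType) : Type :=
| Transl of R
| Refl of R.

Definition uact (R : realType) (g : umove R) (x : R) : R :=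
  match g with Transl t => x + t | Refl r => r - x end.
Coercion uact : umove >-> Funclass.

Definition is_transl (R : realType) (g : umove R) : bool :=
  if g is Transl _ then true else false.

Definition is_refl (R : realType) (g : umove R) : bool := ~~ is_transl g.

Definition ucomp (R : realType) (g2 g1 : umove R) : umove R :=
  match g2, g1 with
  | Transl a, Transl b => Transl (a + b)
  | Transl a, Refl b => Refl (a + b)
  | Refl a, Transl b => Refl (a - b)
  | Refl a, Refl b => Transl (a - b)
  end.

Definition uinv (R : realType) (g : umove R) : umove R :=
  match g with Transl t => Transl (- t) | Refl r => Refl r end.

Lemma ucompE (R : realType) (g2 g1 : umove R) : ucomp g2 g1 = g2 \o g1 :> (R -> R).
Proof.
by apply/funext => x; case: g2 => a; case: g1 => b /=; ring.
Qed.

Lemma uinvK (R : realType) (g : umove R) : cancel g (uinv g).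
Proof. by case: g => a x /=; rewrite ?addrK ?subKr. Qed.

Lemma uinvKV (R : realType) (g : umove R) : cancel (uinv g) g.
Proof. by case: g => a x /=; rewrite ?subrK ?subKr. Qed.

(* "Open interval or empty"; bounded and unbounded intervals are allowed. *)
Definition move_domain (R : realType) (D : set R) : Prop :=
  open D /\ is_interval D.

(* Representative of the empty moves of the same kind as [g]. *)
Definition origin (R : realType) (g : umove R) : umove R :=
  match g with Transl _ => Transl 0 | Refl _ => Refl 0 end.

(* Moves are pairs of an unrestricted move and a domain, except that all empty
   translations, and all empty reflections, have to be identified: a move with
   empty domain is therefore required to carry the parameter 0. *)
Record move (R : realType) : Type := Move {
  mv_map : umove R ;
  mv_dom : set R ;
  mv_domP : move_domain mv_dom ;
  mv_emptyP : mv_dom = set0 -> mv_map = origin mv_map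
}.

Definition unorm (R : realType) (g : umove R) (D : set R) : umove R :=
  if `[< D !=set0 >] then g else origin g.

Lemma unormP (R : realType) (g : umove R) (D : set R) :
  D = set0 -> unorm g D = origin (unorm g D).
Proof.
move=> D0; rewrite /unorm; case: asboolP => [|_]; last by case: g.
by rewrite D0 => -[].
Qed.

(* The move written g|_D. *)
Definition restr (R : realType) (g : umove R) (D : set R) (hD : move_domain D) :
  move R := @Move R (unorm g D) D hD (@unormP R g D).

Lemma move_eq (R : realType) (m1 m2 : move R) :
  mv_map m1 = mv_map m2 -> mv_dom m1 = mv_dom m2 -> m1 = m2.
Proof.
case: m1 m2 => g1 D1 p1 q1 [g2 D2 p2 q2] /= eg eD; subst g2 D2.
by congr Move; exact: Prop_irrelevance.
Qed.

Lemma restr_eqP (R : realType) (g g' : umove R) (D D' : set R)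
    (hD : move_domain D) (hD' : move_domain D') :
  restr g hD = restr g' hD' <->
  D = D' /\ (D !=set0 -> g = g') /\ is_transl g = is_transl g'.
Proof.
split=> [e|[eD [eg ek]]].
  have eD : D = D' by exact: (congr1 (@mv_dom R) e).
  have := congr1 (@mv_map R) e; rewrite /= -eD /unorm.
  case: asboolP => [_ ->//|D0 eo]; split=> //; split=> //.
  by case: g g' eo {e} => a [] b.
apply: move_eq => //=; rewrite -eD /unorm; case: asboolP => [/eg//|_].
by case: g g' ek {eg} => a [] b.
Qed.

Lemma restr_id (R : realType) (m : move R) : restr (mv_map m) (mv_domP m) = m.
Proof.
apply: move_eq => //=; rewrite /unorm; case: asboolP => // /set0P/negP/negPn/eqP.
by move/(@mv_emptyP _ m).
Qed.

Lemma uact_continuous (R : realType) (g : umove R) : continuous (g : R -> R).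
Proof.
case: g => a x /=; first by apply: cvgD; [exact: cvg_id|exact: cvg_cst].
by apply: cvgB; [exact: cvg_cst|exact: cvg_id].
Qed.

Lemma move_domain_preimage (R : realType) (g : umove R) (D : set R) :
  move_domain D -> move_domain (g @^-1` D).
Proof.
move=> [Do iD]; split.
  by apply: open_comp => // x _; exact: uact_continuous.
move=> x y /= Dx Dy z /andP[xz zy]; case: g Dx Dy => a /= Dx Dy.
  by apply: (iD _ _ Dx Dy); rewrite !lerD2r xz.
by apply: (iD _ _ Dy Dx); rewrite !lerD2l !lerN2 xz zy.
Qed.

Lemma move_domain_image (R : realType) (g : umove R) (D : set R) :
  move_domain D -> move_domain (g @` D).
Proof.
have -> : g @` D = uinv g @^-1` D; last exact: move_domain_preimage.
apply/seteqP; split=> [_ [x Dx <-]|x Dx] /=; first by rewrite uinvK.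
by exists (uinv g x); rewrite ?uinvKV.
Qed.

Lemma move_domain_setI (R : realType) (D1 D2 : set R) :
  move_domain D1 -> move_domain D2 -> move_domain (D1 `&` D2).
Proof.
move=> [D1o i1] [D2o i2]; split; first exact: openI.
by move=> x y [x1 x2] [y1 y2] z xzy; split; [exact: i1 xzy|exact: i2 xzy].
Qed.

Definition mcomp (R : realType) (m2 m1 : move R) : move R :=
  restr (ucomp (mv_map m2) (mv_map m1))
    (move_domain_setI (mv_domP m1)
       (move_domain_preimage (mv_map m1) (mv_domP m2))).

Definition minv (R : realType) (m : move R) : move R :=
  restr (uinv (mv_map m)) (move_domain_image (mv_map m) (mv_domP m)).

Lemma mcomp_restr (R : realType) (g2 g1 : umove R) (D2 D1 : set R)
    (h2 : move_domain D2) (h1 : move_domain D1) :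
  mcomp (restr g2 h2) (restr g1 h1) =
  restr (ucomp g2 g1) (move_domain_setI h1 (move_domain_preimage g1 h2)).
Proof.
apply/restr_eqP => /=; split.
  apply/seteqP; split=> x [D1x]; rewrite /unorm /=;
    by (case: asboolP => [_ //|D10]; case: D10; exists x).
split=> [[x [D1x]]|].
  rewrite /unorm /=; case: asboolP => [_ D2x|D10]; last by case: D10; exists x.
  by case: asboolP => // D20; case: D20; exists (g1 x).
by rewrite /unorm; case: asboolP => _; case: asboolP => _; case: g1; case: g2.
Qed.

Lemma minv_restr (R : realType) (g : umove R) (D : set R) (h : move_domain D) :
  minv (restr g h) = restr (uinv g) (move_domain_image g h).
Proof.
apply/restr_eqP => /=; split.
  apply/seteqP; split=> y [x Dx <-]; rewrite /unorm /=;
    by (case: asboolP => [_|D0]; [exists x|case: D0; exists x]).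
rewrite /unorm; case: asboolP => [//|D0]; split; last by case: g.
by move=> [_ [x Dx _]]; case: D0; exists x.
Qed.

(* Move ensembles are the elements of [set (move R)]. *)

Definition move_semigroup (R : realType) (Om : set (move R)) : Prop :=
  (forall m1 m2, Om m1 -> Om m2 -> Om (mcomp m2 m1)) /\
  (forall m, Om m -> Om (minv m)).

(* The move g|_D belongs to Om; this includes that D is a legal domain. *)
Definition has_move (R : realType) (Om : set (move R)) (g : umove R)
  (D : set R) : Prop := exists hD : move_domain D, Om (restr g hD).

Definition mjoin_closed (R : realType) (Om : set (move R)) : Prop :=
  (forall (g : umove R) (D D' : set R),
     has_move Om g D -> move_domain D' -> D' `<=` D -> has_move Om g D') /\
  (forall (g : umove R) (F : set (set R)) (D : set R),
     (forall I, F I -> has_move Om g I) ->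
     D = \bigcup_(I in F) I -> D !=set0 -> is_interval D ->
     has_move Om g D).

Definition mjoin (R : realType) (Om : set (move R)) : set (move R) :=
  smallest (@mjoin_closed R) Om.

Definition umove_cvg (R : realType) (gs : nat -> umove R) (g : umove R) : Prop :=
  match g with
  | Transl t => exists ts : nat -> R,
      (\forall i \near \oo, gs i = Transl (ts i)) /\ ts @ \oo --> t
  | Refl r => exists rs : nat -> R,
      (\forall i \near \oo, gs i = Refl (rs i)) /\ rs @ \oo --> r
  end.

Definition mlim_closed (R : realType) (Om : set (move R)) : Prop :=
  forall (D : set R) (gs : nat -> umove R) (g : umove R),
    D !=set0 -> umove_cvg gs g -> (forall i, has_move Om (gs i) D) ->
    has_move Om g D.

Definition mlim (R : realType) (Om : set (move R)) : set (move R) :=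
  smallest (@mlim_closed R) Om.

Lemma mjoin_closed_mjoin (R : realType) (Om : set (move R)) : mjoin_closed (mjoin Om).
Proof.
split=> [g D D' [hD h] hD' sD|g F D hF eD D0 iD].
  exists hD' => X [cX OX]; have [] := cX.1 g D D' _ hD' sD.
    by exists hD; apply: h.
  by move=> hD2; rewrite (Prop_irrelevance hD2 hD').
have hD : move_domain D.
  by split=> //; rewrite eD; apply: bigcup_open => I /hF[] [].
exists hD => X [cX OX]; have [I /hF[hI h]||//|//|hD2] := cX.2 g F D.
- by exists hI; apply: h.
- exact: eD.
by rewrite (Prop_irrelevance hD2 hD).
Qed.

Lemma mlim_closed_mlim (R : realType) (Om : set (move R)) : mlim_closed (mlim Om).
Proof.
move=> D gs g D0 cg h; have [hD _] := h 0%N.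
exists hD => X [cX OX]; have [|hD2] := cX D gs g D0 cg.
  by move=> i; have [hi H] := h i; exists hi; apply: H.
by rewrite (Prop_irrelevance hD2 hD).
Qed.

Definition moves_plus (R : realType) (O : set (R * R)) : set (move R) :=
  [set m | is_transl (mv_map m) /\
           forall x, mv_dom m x -> O (x, mv_map m x)].

Definition moves_minus (R : realType) (O : set (R * R)) : set (move R) :=
  [set m | is_refl (mv_map m) /\
           forall x, mv_dom m x -> O (x, mv_map m x)].

(* The interval (l, u); infinite endpoints give unbounded open intervals. *)
Definition oitv (R : realType) (l u : \bar R) : set R :=
  [set x : R | (l < x%:E)%E /\ (x%:E < u)%E].

(* Main.v *)
(* Since the approximants differ from g, quotients h^-1 o h' of two of them are
   nonzero translations by arbitrarily small amounts; iterating these inside a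
   compact subinterval of D yields approximations of every translation carrying
   a point of D to a point of D. Local approximability by moves of Gam is stable
   under composition and inverse, so composing with g and g^-1 reaches all pairs
   of points of D and I. Passing to the limit near each point and gluing by
   continuation gives the claimed moves. *)

Require Import Defs.
From mathcomp Require Import all_boot all_order all_algebra.
From mathcomp Require Import all_classical all_reals all_analysis.
From mathcomp Require Import ring lra.
Set Implicit Arguments.
Unset Strict Implicit.
Unset Printing Implicit Defensive.
Import Order.TTheory GRing.Theory Num.Theory numFieldNormedType.Exports.
Local Open Scope classical_set_scope.
Local Open Scope ring_scope.

Section LimitMoves.
Variables (R : realType) (Gam : set (move R)).
Hypotheses (Gam_semigroup : move_semigroup Gam) (Gam_join : mjoin_closed Gam).
Implicit Types (g h : umove R) (D : set R) (a b e r x y z : R).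

(** * Parameters of moves, and composition and inversion of restricted moves *)

Definition upar g : R := match g with Transl t => t | Refl r => r end.

(** Moves are isometries that depend on their parameter with slope 1, so the errors in argument and
    parameter add up. *)
Lemma uact_perturb g h x y r e : is_transl h = is_transl g ->
  `|upar h - upar g| < e -> x - r < y < x + r ->
  g x - (r + e) < h y < g x + (r + e).
Proof.
by case: g h => s [] t //= _; rewrite ltr_norml => /andP[] ? ? /andP[] ? ?;
  apply/andP; split; lra.
Qed.

Lemma move_domain_itvoo a b : move_domain [set` `]a, b[].
Proof. by split; [exact: interval_open|exact: interval_is_interval]. Qed.

Lemma has_move_comp g1 g2 D1 D2 D :
  has_move Gam g1 D1 -> has_move Gam g2 D2 -> move_domain D ->
  D `<=` D1 `&` g1 @^-1` D2 -> has_move Gam (ucomp g2 g1) D.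
Proof.
move=> [h1 G1] [h2 G2] hD sD; apply: (Gam_join.1 _ _ _ _ hD sD).
exists (move_domain_setI h1 (move_domain_preimage g1 h2)).
by rewrite -mcomp_restr; exact: Gam_semigroup.1.
Qed.

Lemma has_move_inv g D D' : has_move Gam g D -> move_domain D' ->
  D' `<=` uinv g @^-1` D -> has_move Gam (uinv g) D'.
Proof.
move=> [hD G1] hD' sD; apply: (Gam_join.1 _ (g @` D) _ _ hD').
  exists (move_domain_image g hD).
  by rewrite -minv_restr; exact: Gam_semigroup.2.
by move=> y /sD; exists (uinv g y) => //; rewrite uinvKV.
Qed.

(** * Small translations as quotients of approximants *)

Definition shift_dom a b e : set R :=
  [set` `]a, b[] `&` (fun x => x + e) @^-1` [set` `]a, b[].

Lemma move_domain_shift a b e : move_domain (shift_dom a b e).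
Proof.
apply: move_domain_setI; first exact: move_domain_itvoo.
exact: (@move_domain_preimage _ (Transl e) _ (move_domain_itvoo a b)).
Qed.

(** For [g] and [h] on a common domain, the quotient is defined exactly where a point and its shift
    by [e] both lie in that domain; this is what [shift_dom] encodes. *)
Lemma has_move_quotient g h a b e : ucomp (uinv h) g = Transl e ->
  has_move Gam g [set` `]a, b[] -> has_move Gam h [set` `]a, b[] ->
  has_move Gam (Transl e) (shift_dom a b e).
Proof.
move=> eE Gg Gh; rewrite -eE; set D := [set` `]a, b[] in Gg Gh.
have Gi : has_move Gam (uinv h) (uinv h @^-1` D).
  apply: has_move_inv Gh _ _ => //.
  exact: move_domain_preimage (move_domain_itvoo a b).
apply: has_move_comp Gg Gi (move_domain_shift a b e) _ => x [Dx Dxe].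
split=> //=; have /(congr1 (fun f => f x)) /= := ucompE (uinv h) g.
by rewrite eE /= => <-.
Qed.

(** Since [e] is positive, the iterates of a point increase: if the first and the last lie in []a,
    b[], so do all in between, and iterating loses no domain. *)
Lemma has_move_shift_mulrn a b e (k : nat) : 0 < e ->
  has_move Gam (Transl e) (shift_dom a b e) ->
  has_move Gam (Transl (e *+ k.+1)) (shift_dom a b (e *+ k.+1)).
Proof.
move=> e0 Ge; elim: k => // k IH; rewrite mulrS.
have : 0 < e *+ k.+1 by rewrite pmulrn_lgt0.
move: (e *+ _) IH => d Gd d0.
apply: (has_move_comp Gd Ge (move_domain_shift _ _ _)) => x.
by rewrite /shift_dom /= !in_itv /= => -[/andP[? ?] /andP[? ?]];
  do 2![split]; rewrite ?in_itv /=; apply/andP; split; lra.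
Qed.

(** The sequence is replaced by an epsilon condition on one fixed bounded interval; the bound [0 <]
    records that approximants differ from [g]. *)
Definition limit_on g a b := forall eps, 0 < eps -> exists h,
  [/\ is_transl h = is_transl g, 0 < `|upar h - upar g| < eps &
      has_move Gam h [set` `]a, b[]].

Lemma limit_on_small_shift g a b eps : limit_on g a b -> 0 < eps ->
  exists2 e, 0 < e < eps & has_move Gam (Transl e) (shift_dom a b e).
Proof.
move=> lg eps0; have [|g1 [k1 /andP[g1n g1e] G1]] := lg (eps / 2); first lra.
(* Taking [g2] strictly closer to [g] than [g1] forces distinct parameters. *)
have [|g2 [k2 /andP[_ g2e] G2]] := lg (Num.min (eps / 2) `|upar g1 - upar g|).
  by rewrite lt_min g1n andbT; lra.
(* The quotient is [h2^-1 o h1] for translations but [h1^-1 o h2] for reflections. *)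
have shift h1 h2 : is_transl h1 = is_transl h2 ->
    has_move Gam h1 [set` `]a, b[] -> has_move Gam h2 [set` `]a, b[] ->
    has_move Gam (Transl (upar h1 - upar h2))
      (shift_dom a b (upar h1 - upar h2)).
  case: h1 h2 => s [] t //= _ ? ?.
    by apply: (@has_move_quotient (Transl s) (Transl t)); rewrite //= addrC.
  exact: (@has_move_quotient (Refl t) (Refl s)).
have k12 : is_transl g1 = is_transl g2 by rewrite k1 k2.
move: g2e; rewrite lt_min => /andP[g2e g21].
have ne : upar g1 != upar g2.
  by apply/eqP => e; move: g21; rewrite e ltxx.
have d12 : `|upar g1 - upar g2| < eps.
  have -> : upar g1 - upar g2 = (upar g1 - upar g) - (upar g2 - upar g) by ring.
  by apply: le_lt_trans (ler_normB _ _) _; lra.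
move: d12; rewrite ltr_norml => /andP[? ?].
case: (ltgtP (upar g1) (upar g2)) ne => // g12 _.
  by exists (upar g2 - upar g1); [lra|exact: shift].
by exists (upar g1 - upar g2); [lra|exact: shift].
Qed.

(** * Local approximability by moves of [Gam] *)

Definition near_dom x r : set R := [set` `]x - r, x + r[].

Lemma move_domain_near x r : move_domain (near_dom x r).
Proof. exact: move_domain_itvoo. Qed.

(* Approximability is phrased with elements of Gam because, unlike Gam, its
   limit closure is not known to be closed under composition. *)
Definition approx g x := exists2 r, 0 < r & forall eps, 0 < eps ->
  exists h, [/\ is_transl h = is_transl g, `|upar h - upar g| < eps &
                has_move Gam h (near_dom x r)].

Lemma approx_comp g h x :
  approx g x -> approx h (g x) -> approx (ucomp h g) x.
Proof.
move=> [r1 r10 A1] [r2 r20 A2].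
(* Half of [r2] absorbs the distance of the argument from [x], the other half the error of [g'], so
   [g'] lands where [h'] is defined. *)
exists (Num.min r1 (r2 / 2)) => [|eps eps0]; first by rewrite lt_min r10 /=; lra.
have [|g' [kg dg Gg]] := A1 (Num.min (eps / 2) (r2 / 2)).
  by rewrite lt_min; apply/andP; split; lra.
have [|h' [kh dh Gh]] := A2 (eps / 2); first lra.
move: dg; rewrite lt_min => /andP[dg dg'].
exists (ucomp h' g'); split.
- by case: g g' h h' kg kh {A1 A2 dg dg' dh Gg Gh} => ? [] ? [] ? [] ?.
- case: g g' h h' kg kh dg dh {A1 A2 dg' Gg Gh} => ? [] ? [] ? [] ? //= _ _;
    rewrite !ltr_norml => /andP[? ?] /andP[? ?]; apply/andP; split; lra.
- apply: (has_move_comp Gg Gh (move_domain_near _ _)) => z.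
  rewrite /near_dom /= !in_itv /=; set m := Num.min _ _.
  have [m1 m2] : m <= r1 /\ m <= r2 / 2 by rewrite !ge_min !lexx orbT.
  move=> /andP[z1 z2]; split; first by apply/andP; split; lra.
  have /(uact_perturb kg dg') : x - r2 / 2 < z < x + r2 / 2.
    by apply/andP; split; lra.
  by rewrite -splitr.
Qed.

Lemma approx_inv g x : approx g x -> approx (uinv g) (g x).
Proof.
(* With parameter error below [r / 2], [uinv h] maps the ball of radius [r / 2] around [g x] into
   the domain of [h]. *)
move=> [r r0 A]; exists (r / 2) => [|eps eps0]; first lra.
have [|h [kh dh Gh]] := A (Num.min eps (r / 2)).
  by rewrite lt_min eps0; lra.
move: dh; rewrite lt_min => /andP[dh dh'].
have ki : is_transl (uinv h) = is_transl (uinv g).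
  by case: g h kh {A dh dh' Gh} => ? [] ?.
have di d : `|upar h - upar g| < d -> `|upar (uinv h) - upar (uinv g)| < d.
  by case: g h kh {A dh dh' Gh ki} => ? [] ? //= _; rewrite -opprD normrN.
exists (uinv h); split=> //; first exact: di.
apply: has_move_inv Gh (move_domain_near _ _) _ => z.
rewrite /near_dom /= !in_itv /= => /(uact_perturb ki (di _ dh')).
by rewrite uinvK -splitr.
Qed.

Lemma limit_on_approx g a b x : a < x < b -> limit_on g a b -> approx g x.
Proof.
move=> /andP[ax xb] lg; exists (Num.min (x - a) (b - x)) => [|eps /lg].
  by rewrite lt_min; apply/andP; split; lra.
move=> [h [kh /andP[_ dh] Gh]]; exists h; split=> //.
apply: (Gam_join.1 _ _ _ Gh (move_domain_near _ _)) => z.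
rewrite /near_dom /= !in_itv /=; set m := Num.min _ _.
have [m1 m2] : m <= x - a /\ m <= b - x by rewrite !ge_min !lexx orbT.
by move=> /andP[? ?]; apply/andP; split; lra.
Qed.

(* The multiple of a small shift e closest to y - x from above approximates
   y - x within e. *)
Lemma limit_on_approx_transl_le g a b x y : a < x -> x <= y -> y < b ->
  limit_on g a b -> approx (Transl (y - x)) x.
Proof.
(* One [r] of the margin is for the neighbourhood of [x], the other for overshooting [y - x] by at
   most [e < r]. *)
move=> ax xy yb lg; pose r := Num.min (x - a) (b - y) / 2.
have r0 : 0 < r by rewrite divr_gt0// lt_min; apply/andP; split; lra.
have [r1 r2] : r *+ 2 <= x - a /\ r *+ 2 <= b - y.
  by rewrite -mulr_natr divfK// !ge_min !lexx orbT.
exists r => // eps eps0.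
have [|e /andP[e0 em] Ge] := @limit_on_small_shift g a b (Num.min eps r) lg.
  by rewrite lt_min eps0.
move: em; rewrite lt_min => /andP[eeps er].
have /truncn_itv/andP[] : 0 <= (y - x) / e by rewrite divr_ge0 ?subr_ge0// ltW.
have {Ge} := @has_move_shift_mulrn a b e (Num.truncn ((y - x) / e)) e0 Ge.
rewrite ler_pdivlMr// ltr_pdivrMr// !mulr_natl mulrSr.
move: (e *+ _) => d Gd d1 d2; exists (Transl (d + e)); split=> //=.
  by rewrite ltr_norml; apply/andP; split; lra.
apply: (Gam_join.1 _ _ _ Gd (move_domain_near _ _)) => z.
rewrite /near_dom /shift_dom /= !in_itv /= => /andP[? ?].
by split; rewrite ?in_itv /=; apply/andP; split; lra.
Qed.

Lemma limit_on_approx_transl g a b x y : a < x < b -> a < y < b ->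
  limit_on g a b -> approx (Transl (y - x)) x.
Proof.
move=> /andP[ax xb] /andP[ay yb] lg; have [xy|yx] := leP x y.
  exact: limit_on_approx_transl_le xy yb lg.
(* Leftward translations are inverses of rightward ones. *)
have := approx_inv (limit_on_approx_transl_le ay (ltW yx) xb lg).
by rewrite /= opprB addrCA subrr addr0.
Qed.

(** * Passage to the limit and gluing *)

Lemma approx_mlim g x : approx g x ->
  exists2 r, 0 < r & has_move (mlim Gam) g (near_dom x r).
Proof.
move=> [r r0 A]; exists r => //.
(* The radius [r] does not depend on the precision, so approximants of precision [1 / (n + 1)] share
   one domain, as [mlim_closed] demands. *)
have /(_ _)/cid := fun n => A n.+1%:R^-1 ltac:(by rewrite invr_gt0).
move=> /all_sig[hs /all_and3[ks ds Gs]].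
have cds : upar \o hs @ \oo --> upar g.
  apply/cvgrPdist_lt => eps eps0.
  have /cvgrPdist_lt/(_ _ eps0) := @cvg_harmonic R.
  apply: filterS => n; rewrite sub0r normrN ger0_norm ?invr_ge0// => ne.
  by rewrite distrC; apply: lt_trans (ds n) _.
apply: (@mlim_closed_mlim _ _ _ hs).
- by exists x; rewrite /near_dom /= in_itv /=; apply/andP; split; lra.
- case: g ks cds {A ds} => s ks cds; exists (upar \o hs); split => //;
  by apply: nearW => n /=; have := ks n; case: (hs n).
- move=> n; have [hD Gn] := Gs n; exists hD => X [_]; exact.
Qed.

Lemma sub_mjoin (Om : set (move R)) g D :
  has_move Om g D -> has_move (mjoin Om) g D.
Proof. by move=> [hD Og]; exists hD => X [_]; apply. Qed.

(** The witness [h] serves the case of an empty [m]: all empty moves of one kind coincide, so [m] is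
    a restriction of any available move of its kind. A nonempty [m] is glued from its local
    pieces. *)
Lemma approx_mjoin (m : move R) h x0 : approx h x0 ->
  is_transl h = is_transl (mv_map m) ->
  (forall x, mv_dom m x -> approx (mv_map m) x) -> mjoin (mlim Gam) m.
Proof.
move=> Ah kh Am; rewrite -(restr_id m); move: (mv_domP m) => hD.
suff [hD' ?] : has_move (mjoin (mlim Gam)) (mv_map m) (mv_dom m).
  by rewrite (Prop_irrelevance hD hD').
have [m0|/set0P m0] := eqVneq (mv_dom m) set0.
  have [r _ /sub_mjoin Gh] := approx_mlim Ah.
  have [h0 J0] : has_move (mjoin (mlim Gam)) h (mv_dom m).
    by apply: (@mjoin_closed_mjoin _ _).1 Gh hD _; rewrite m0; exact: sub0set.
  exists h0; congr mjoin: J0; apply/restr_eqP; split=> //; split=> //.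
  by rewrite m0 => -[].
apply: ((@mjoin_closed_mjoin _ _).2 _
  [set D | has_move (mjoin (mlim Gam)) (mv_map m) D /\ D `<=` mv_dom m]).
- by move=> D [].
- apply/seteqP; split=> [x mx|x [D [_ sD] Dx]]; last exact: sD.
  have [r r0 /sub_mjoin Gr] := approx_mlim (Am x mx).
  exists (near_dom x r `&` mv_dom m).
    split; last by move=> ? [].
    apply: (@mjoin_closed_mjoin _ _).1 Gr _ _; last by move=> ? [].
    exact: move_domain_setI (move_domain_near _ _) hD.
  by split=> //; rewrite /near_dom /= in_itv /=; apply/andP; split; lra.
- exact: m0.
- exact: hD.2.
Qed.

(** * Moves as links between points *)

Definition link (t : bool) x y : umove R :=
  if t then Transl (y - x) else Refl (x + y).

(** A move is determined by its kind and the image of one point, so approximability becomes a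
    relation between points. *)
Lemma linkE g x : g = link (is_transl g) x (g x).
Proof. by case: g => a; rewrite /link /=; congr (_ _); ring. Qed.

Definition linked (t : bool) x y := approx (link t x y) x.

(** A composite is a translation exactly when both factors have the same kind, hence [s == t]. *)
Lemma linked_trans s t x y z :
  linked s x y -> linked t y z -> linked (s == t) x z.
Proof.
have xyE : link s x y x = y by case: s; rewrite /link /=; ring.
move=> Axy; rewrite /linked -[X in approx _ X]xyE => /(approx_comp Axy).
by congr (approx _ _); case: s t {xyE Axy} => [] [] /=; congr (_ _); ring.
Qed.

Lemma linked_sym t x y : linked t x y -> linked t y x.
Proof.
move=> /approx_inv; congr (approx _ _); case: t; rewrite /link /=.
- by congr (_ _); ring.
- by congr (_ _); ring.
- by ring.
- by ring.
Qed.

End LimitMoves.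

(** * Intervals with extended endpoints and convergent sequences of moves *)

Lemma oitv_nonempty (R : realType) (l u : \bar R) :
  (l < u)%E -> oitv l u !=set0.
Proof.
case: l u => [l| |] [u| |] //=; rewrite ?lte_fin => lu.
- by exists ((l + u) / 2); split; rewrite lte_fin; lra.
- by exists (l + 1); split; rewrite ?ltry// lte_fin; lra.
- by exists (u - 1); split; rewrite ?ltNyr// lte_fin; lra.
- by exists 0; split; rewrite ?ltry ?ltNyr.
Qed.

(** The strict gaps between [a], [b] and the endpoints let converging domains eventually contain
    []a, b[]. *)
Lemma oitv_enclose (R : realType) (l u : \bar R) (x y : R) :
  oitv l u x -> oitv l u y ->
  exists a b, [/\ (l < a%:E)%E, (b%:E < u)%E, a < x < b & a < y < b].
Proof.
wlog xy : x y / x <= y => [H Dx Dy|[lx xu] [ly yu]].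
  have [xy|/ltW yx] := leP x y; first exact: H.
  by have [a [b []]] := H _ _ yx Dy Dx; exists a, b.
have [d Hd] := lt_ereal_nbhs lx xu; have [e He] := lt_ereal_nbhs ly yu.
have d0 : 0 < d%:num by []. have e0 : 0 < e%:num by [].
exists (x - d%:num / 2), (y + e%:num / 2); split.
- have /andP[//] : (l < (x - d%:num / 2)%:E < u)%E.
  by apply: Hd; rewrite addrAC subrr add0r normrN gtr0_norm; lra.
- have /andP[//] : (l < (y + e%:num / 2)%:E < u)%E.
  by apply: He; rewrite addrAC subrr add0r gtr0_norm; lra.
- by apply/andP; split; lra.
- by apply/andP; split; lra.
Qed.

Lemma umove_cvgP (R : realType) (gs : nat -> umove R) (g : umove R) (eps : R) :
  umove_cvg gs g -> 0 < eps -> \forall i \near \oo,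
    is_transl (gs i) = is_transl g /\ `|upar (gs i) - upar g| < eps.
Proof.
by case: g => s [ss [gsE /cvgrPdist_lt cs]] /cs; apply: filterS2 gsE => i ->;
  rewrite distrC.
Qed.

Lemma limit_on_cvg (R : realType) (Gam : set (move R))
  (Gam_join : mjoin_closed Gam) (l u : \bar R) (g : umove R)
  (gs : nat -> umove R) (Ds : nat -> set R)
  (Gam_gs : forall i, has_move Gam (gs i) (Ds i))
  (gs_neq : forall i, gs i <> g) (gs_cvg : umove_cvg gs g)
  (Ds_cvg : (forall i, Ds i = oitv l u) \/
     exists ls us : nat -> \bar R,
       [/\ forall i, Ds i = oitv (ls i) (us i),
           ls @ \oo --> l & us @ \oo --> u]) (a b : R) :
  (l < a%:E)%E -> (b%:E < u)%E -> limit_on Gam g a b.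
Proof.
move=> la bu eps eps0.
have sD : \forall i \near \oo, [set` `]a, b[] `<=` Ds i.
  have sub l' u' : (l' < a%:E)%E -> (b%:E < u')%E ->
      [set` `]a, b[] `<=` oitv l' u'.
    move=> l'a bu' x; rewrite /= in_itv /= => /andP[ax xb].
    by split; [apply: lt_trans l'a _|apply: lt_trans _ bu']; rewrite lte_fin.
  case: Ds_cvg => [DsE|[ls [us [DsE cl cu]]]].
    by apply: nearW => i; rewrite DsE; exact: sub.
  have nl : \forall i \near \oo, (ls i < a%:E)%E.
    apply: (cl [set y | (y < a%:E)%E]).
    by apply: open_nbhs_nbhs; split=> //; exact: open_ereal_lt_ereal.
  have nu : \forall i \near \oo, (b%:E < us i)%E.
    apply: (cu [set y | (b%:E < y)%E]).
    by apply: open_nbhs_nbhs; split=> //; exact: open_ereal_gt_ereal.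
  by apply: filterS2 nl nu => i *; rewrite DsE; exact: sub.
have [i [sDi [ki di]]] := filter_ex (filterI sD (umove_cvgP gs_cvg eps0)).
exists (gs i); split=> //; last first.
  exact: (Gam_join.1 _ _ _ (Gam_gs i) (move_domain_itvoo a b)).
(* Equal kind and equal parameter would make [gs i] equal to [g]. *)
rewrite di andbT normr_gt0 subr_eq0; apply/eqP => e.
by apply: (gs_neq i); move: ki e; case: (gs i) => s; case: (g) => t //= _ ->.
Qed.

Theorem theorem7p9 (R : realType) (Gam : set (move R))
  (Gam_semigroup : move_semigroup Gam) (Gam_join : mjoin_closed Gam)
  (l u : \bar R) (lu : (l < u)%E) (g : umove R)
  (gs : nat -> umove R) (Ds : nat -> set R)
  (Gam_gs : forall i, has_move Gam (gs i) (Ds i))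
  (gs_neq : forall i, gs i <> g)
  (gs_cvg : umove_cvg gs g)
  (Ds_cvg : (forall i, Ds i = oitv l u) \/
     exists ls us : nat -> \bar R,
       [/\ forall i, Ds i = oitv (ls i) (us i),
           ls @ \oo --> l & us @ \oo --> u]) :
  let D : set R := oitv l u in
  let I : set R := g @` D in
  (is_transl g ->
     moves_plus ((D `|` I) `*` (D `|` I)) `<=` mjoin (mlim Gam)) /\
  (is_refl g ->
     moves_minus ((D `*` I) `|` (I `*` D)) `<=` mjoin (mlim Gam) /\
     moves_plus ((D `*` D) `|` (I `*` I)) `<=` mjoin (mlim Gam)).
Proof.
move=> D I.
have lim := limit_on_cvg Gam_join Gam_gs gs_neq gs_cvg Ds_cvg.
have lDD x y : D x -> D y -> linked Gam true x y.
  move=> Dx Dy; have [a [b [la bu axb ayb]]] := oitv_enclose Dx Dy.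
  exact: (limit_on_approx_transl Gam_semigroup Gam_join axb ayb (lim _ _ la bu)).
(* Translate [x] within [D] to the preimage [x'] of [y], then apply [g]. *)
have lDI x y : D x -> I y -> linked Gam (is_transl g) x y.
  move=> Dx [x' Dx' <-]; have := lDD _ _ Dx Dx'.
  have [a [b [la bu axb _]]] := oitv_enclose Dx' Dx'.
  have := limit_on_approx Gam_join axb (lim _ _ la bu).
  rewrite {1}(linkE g x') => lg lxx'.
  exact: (linked_trans Gam_semigroup Gam_join lxx' lg).
have lID x y : I x -> D y -> linked Gam (is_transl g) x y.
  by move=> Ix Dy; apply: (linked_sym Gam_semigroup Gam_join); exact: lDI.
have [x0 Dx0] := oitv_nonempty lu.
(* The detour through [x0] in [D] uses two links of the kind of [g], whose composite is a
   translation in either case. *)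
have lII x y : I x -> I y -> linked Gam true x y.
  move=> Ix Iy; rewrite -(eqxx (is_transl g)).
  exact: (linked_trans Gam_semigroup Gam_join (lID _ _ Ix Dx0) (lDI _ _ Dx0 Iy)).
(* The link from [x] to [y] only provides an approximable move of kind [t], for the case of empty
   [m]. *)
have main t x y m : linked Gam t x y -> is_transl (mv_map m) = t ->
    (forall z, mv_dom m z -> linked Gam t z (mv_map m z)) ->
    mjoin (mlim Gam) m.
  move=> lxy mt lm; apply: (approx_mjoin lxy).
    by rewrite mt; case: t {lxy mt lm}.
  by move=> z /lm; rewrite /linked -mt -linkE.
split=> [tg|rg].
  rewrite tg in lDI lID => m [mt mO]; apply: main (lDD _ _ Dx0 Dx0) mt _ => z.
  by move=> /mO[[Dz|Iz] [Dy|Iy]]; [exact: lDD|exact: lDI|exact: lID|exact: lII].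
rewrite (negbTE rg) in lDI lID; split=> m [mt mO].
  have Ig : I (g x0) by exists x0.
  apply: main (lDI _ _ Dx0 Ig) (negbTE mt) _ => z.
  by move=> /mO[[Dz Iy]|[Iz Dy]]; [exact: lDI|exact: lID].
apply: main (lDD _ _ Dx0 Dx0) mt _ => z.
by move=> /mO[[Dz Dy]|[Iz Iy]]; [exact: lDD|exact: lII].
Qed.
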